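(* Let $n\ge 0$ be an integer and let $M=x_0^2x_1^2\cdots x_n^2\in\mathbb{R}[x_0,\ldots,x_n]$. Then $$\mathrm{rk}_{\mathbb{R}}(M)\le \frac{3^{n+1}-1}{2}.$$
   Context: For a field $\mathbb{K}$ and a homogeneous polynomial $F\in\mathbb{K}[x_0,\ldots,x_n]$ of degree $d$, a Waring decomposition of $F$ over $\mathbb{K}$ is an expression $F=\sum_{i=1}^s c_iL_i^d$ with $c_i\in\mathbb{K}$ and $L_i\in\mathbb{K}[x_0,\ldots,x_n]$ linear forms (homogeneous of degree 1). The Waring rank of $F$ over $\mathbb{K}$, denoted $\mathrm{rk}_{\mathbb{K}}(F)$, is the smallest $s$ for which such a decomposition exists. *)

(* Defs.v *)
From HB Require Import structures.
From mathcomp Require Import all_boot all_order all_algebra.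
From mathcomp Require Import mpoly.

Set Implicit Arguments.
Unset Strict Implicit.
Unset Printing Implicit Defensive.

Import GRing.Theory.
Local Open Scope ring_scope.

(* The degree [d] is an explicit parameter, since it cannot be read off the
   zero polynomial.  The zero form is 1-homogeneous, hence an admissible [L i]. *)
Definition waring_decomposition (K : fieldType) (m d : nat) (F : {mpoly K[m]})
    (s : nat) (c : 'I_s -> K) (L : 'I_s -> {mpoly K[m]}) : Prop :=
  (forall i, L i \is 1.-homog) /\ F = \sum_(i < s) c i *: L i ^+ d.

Definition has_waring_decomposition (K : fieldType) (m d : nat)
    (F : {mpoly K[m]}) (s : nat) : Prop :=
  exists (c : 'I_s -> K) (L : 'I_s -> {mpoly K[m]}),
    waring_decomposition d F c L.

(* A relation rather than a function: a form that admits no decomposition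
   (possible in positive characteristic) then has no rank at all, instead of
   a junk value. *)
Definition is_waring_rank (K : fieldType) (m d : nat) (F : {mpoly K[m]})
    (r : nat) : Prop :=
  has_waring_decomposition d F r /\
  forall s : nat, has_waring_decomposition d F s -> (r <= s)%N.

Lemma is_waring_rank_uniq (K : fieldType) (m d : nat) (F : {mpoly K[m]})
    (r r' : nat) :
  is_waring_rank d F r -> is_waring_rank d F r' -> r = r'.
Proof.
move=> [Hr minr] [Hr' minr']; apply/eqP.
by rewrite eqn_leq minr // minr'.
Qed.

Lemma prod_sqr_dhomog (K : fieldType) (m : nat) :
  (\prod_(i < m) 'X_i ^+ 2 : {mpoly K[m]}) \is (2 * m).-homog.
Proof.
have -> : (2 * m = \sum_(i < m) 2)%N by rewrite sum_nat_const card_ord mulnC.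
elim/big_rec2: _ => [|i d p _ Hp]; first exact: dhomog1.
apply: dhomogM => //.
have HX : ('X_i : {mpoly K[m]}) \is 1.-homog by rewrite dhomogX /= mdeg1.
exact: (dhomogMn 2 HX).
Qed.

(* Main.v *)
Require Import Defs.
From mathcomp Require Import all_boot all_order all_algebra.
From mathcomp Require Import boolp reals.
From mathcomp Require Import mpoly.
From mathcomp Require Import ring zify.

(** Apply to [(e_0 x_0 + ... + e_n x_n)^(2(n+1))] the product over [i] of the
    second differences [f(1) - 2 f(0) + f(-1)] in the variable [e_i].  A second
    difference kills [e^k] for [k = 0] and for [k] odd, so in degree [2(n+1)]
    only the monomial with all exponents equal to 2 survives, and a nonzero
    multiple of [M] is written as a sum over [e] in [{-1,0,1}^(n+1)].  The term
    [e = 0] vanishes and the terms [e] and [-e] agree, so half of the nonzero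
    [e] suffice. *)

Set Implicit Arguments.
Unset Strict Implicit.
Unset Printing Implicit Defensive.

Import Order.TTheory GRing.Theory Num.Theory.
Local Open Scope ring_scope.

Section SecondDifferences.
Variable K : numFieldType.

(* The elements 0, 1, 2 of ['I_3] stand for the nodes -1, 0, 1, so that
   [rev_ord] is negation. *)
Definition node (t : 'I_3) : K := t%:R - 1.
Definition weight (t : 'I_3) : K := if t == 1 :> nat then - 2 else 1.

Lemma node_rev (t : 'I_3) : node (rev_ord t) = - node t.
Proof.
rewrite /node /=.
by case: t => [[|[|[|//]]] lt_t3] /=; rewrite ?subn1 ?subn2 ?subnn /=; ring.
Qed.

Lemma weight_rev (t : 'I_3) : weight (rev_ord t) = weight t.
Proof. by case: t => [[|[|[|//]]] lt_t3]. Qed.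

Lemma moment (k : nat) :
  \sum_t weight t * node t ^+ k = if odd k || (k == 0) then 0 else 2.
Proof.
rewrite !big_ord_recl big_ord0 /weight /node /= /bump /=.
(* The sum is [(-1)^k - 2 * 0^k + 1], where [0^0 = 1] makes the case [k = 0] vanish. *)
rewrite subrr sub0r expr0n -signr_odd.
have -> : (1 + 1)%N%:R - 1 = 1 :> K by rewrite natrD addrK.
by rewrite expr1n; case: k => [|k] /=; [|case: (odd k)] => /=; ring.
Qed.

End SecondDifferences.

Section PowerOfSum.
Variables (m d : nat).
Implicit Type f : {ffun 'I_d -> 'I_m}.

Definition fiber_card f (i : 'I_m) : nat := #|[pred j | f j == i]|.

Lemma sum_fiber_card f : (\sum_i fiber_card f i = d)%N.
Proof.
rewrite -[RHS]card_ord -sum1_card (partition_big f predT) //=.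
by apply: eq_bigr => i _; rewrite sum1_card.
Qed.

(** Indexing the expansion by the choice [f] of a summand in each factor avoids multinomial
    coefficients: they reappear as numbers of [f] with prescribed fiber sizes. *)
Lemma expr_sum_ffun (A : comNzRingType) (a : 'I_m -> A) :
  (\sum_i a i) ^+ d = \sum_f \prod_i a i ^+ fiber_card f i.
Proof.
rewrite -[d in LHS]card_ord -prodr_const bigA_distr_bigA /=.
apply: eq_bigr => f _; rewrite (partition_big f predT) //=.
apply: eq_bigr => i _; rewrite -prodr_const.
by apply: eq_bigr => j /eqP ->.
Qed.

End PowerOfSum.

(** A nonzero even number is at least 2, so a total of [2 * m] leaves no slack. *)
Lemma all2_of_sum_even (m : nat) (k : 'I_m -> nat) :
  (forall i, ~~ odd (k i) && (k i != 0%N)) -> (\sum_i k i = 2 * m)%N ->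
  forall i, k i = 2.
Proof.
move=> even_k sum_k.
have k_ge2 i : (2 <= k i)%N by have := even_k i; case: (k i) => [|[|]].
have : (\sum_(i < m) (k i - 2) = 0)%N.
  rewrite sumnB // sum_k sum_nat_const card_ord; lia.
move=> /eqP; rewrite sum_nat_eq0 => /forallP k_le2 i.
by apply/eqP; rewrite eqn_leq k_ge2 andbT -subn_eq0; exact: k_le2.
Qed.

(** The map [j %/ 2] has fibers [{2i, 2i+1}]. This ensures that the coefficient of the surviving
    monomial is nonzero. *)
Lemma exists_fibers2 (m : nat) :
  exists f : {ffun 'I_(2 * m) -> 'I_m}, [forall i, fiber_card f i == 2].
Proof.
have half_lt (j : 'I_(2 * m)) : (j %/ 2 < m)%N.
  by have := ltn_ord j; lia.
pose f := [ffun j => Ordinal (half_lt j)].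
exists f; apply/forallP => i; apply/eqP; move: i.
apply: (all2_of_sum_even _ (sum_fiber_card f)) => i.
have lt0 : (2 * i < 2 * m)%N by have := ltn_ord i; lia.
have lt1 : (2 * i + 1 < 2 * m)%N by have := ltn_ord i; lia.
suff -> : fiber_card f i = #|[set Ordinal lt0; Ordinal lt1]|.
  by rewrite cards2 -val_eqE /=; case: eqP => //; lia.
apply: eq_card => j; rewrite !inE ffunE -!val_eqE /=; lia.
Qed.

Section Decomposition.
Variables (K : numFieldType) (m : nat).
Implicit Type e : {ffun 'I_m -> 'I_3}.

Definition coef e : K := \prod_i weight K (e i).
Definition form e : {mpoly K[m]} := \sum_i node K (e i) *: 'X_i.
Definition opp_node e : {ffun 'I_m -> 'I_3} := [ffun i => rev_ord (e i)].

Lemma form_homog e : form e \is 1.-homog.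
Proof.
by apply: rpred_sum => i _; apply: rpredZ; rewrite dhomogX /= mdeg1.
Qed.

Lemma opp_nodeK : involutive opp_node.
Proof. by move=> e; apply/ffunP => i; rewrite !ffunE rev_ordK. Qed.

Lemma coef_opp e : coef (opp_node e) = coef e.
Proof. by apply: eq_bigr => i _; rewrite ffunE weight_rev. Qed.

Lemma form_opp e : form (opp_node e) = - form e.
Proof.
by rewrite /form -sumrN; apply: eq_bigr => i _; rewrite ffunE node_rev scaleNr.
Qed.

(** Since [inord 1] stands for the node 0, the constant function here is the vector [e = 0]. *)
Lemma opp_node_fixed e : (opp_node e == e) = (e == [ffun=> inord 1]).
Proof.
apply/eqP/eqP => [fix_e|->]; apply/ffunP => i; last first.
  by rewrite !ffunE; apply/val_inj; rewrite /= inordK.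
move/ffunP/(_ i)/(congr1 val): fix_e; rewrite !ffunE /= => fix_ei.
by apply/val_inj; rewrite /= inordK //; have := ltn_ord (e i); lia.
Qed.

Lemma form0 : form [ffun=> inord 1] = 0.
Proof.
by apply: big1 => i _; rewrite ffunE /node inordK // subrr scale0r.
Qed.

(** [N] counts the maps [f] with all fibers of size 2, and [2 ^+ m] is the product of the [m] second
    moments. *)
Lemma sum_all_nodes :
  exists2 N : nat, (0 < N)%N &
    \sum_e coef e *: form e ^+ (2 * m) =
      (N%:R * 2 ^+ m) *: \prod_(i < m) 'X_i ^+ 2.
Proof.
pose S :=
  [pred f : {ffun 'I_(2 * m) -> 'I_m} | [forall i, fiber_card f i == 2]].
exists #|S|.
  by have [f Sf] := exists_fibers2 m; apply/card_gt0P; exists f.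
pose mon (f : {ffun 'I_(2 * m) -> 'I_m}) : {mpoly K[m]} :=
  \prod_i 'X_i ^+ fiber_card f i.
pose mom k : K := \sum_t weight K t * node K t ^+ k.
(* For fixed [f], the sum over [e] factors into one moment per variable. *)
transitivity (\sum_f (\prod_i mom (fiber_card f i)) *: mon f).
  under [RHS]eq_bigr do rewrite bigA_distr_bigA scaler_suml.
  rewrite exchange_big /=; apply: eq_bigr => e _.
  rewrite expr_sum_ffun scaler_sumr; apply: eq_bigr => f _.
  under eq_bigr do rewrite exprZn.
  by rewrite scaler_prod scalerA -big_split.
(* Outside [S] some fiber is empty or of odd size, and its moment is zero. *)
rewrite (bigID S) /= [X in _ + X]big1 ?addr0; last first.
  move=> f notSf; have [/forallP even_f|] :=
    boolP [forall i, ~~ odd (fiber_card f i) && (fiber_card f i != 0%N)].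
    case/negP: notSf; apply/forallP => i.
    by rewrite (all2_of_sum_even even_f) // sum_fiber_card.
  rewrite negb_forall => /existsP[i odd_i].
  rewrite (bigD1 i) //= /mom moment.
  by rewrite negb_and !negbK in odd_i; rewrite odd_i mul0r scale0r.
rewrite mulr_natl -scalerMnl -sumr_const; apply: eq_bigr => f /forallP f2.
congr (_ *: _); last by apply: eq_bigr => i _; rewrite (eqP (f2 i)).
rewrite -[in RHS](card_ord m) -prodr_const; apply: eq_bigr => i _.
by rewrite (eqP (f2 i)) /mom moment.
Qed.

(* An arbitrary choice of one element in each pair [{e, -e}] with [e != 0]. *)
Definition half_nodes : {set {ffun 'I_m -> 'I_3}} :=
  [set e | (enum_rank e < enum_rank (opp_node e))%N].

Lemma sum_nodes_half (V : nmodType) (F : {ffun 'I_m -> 'I_3} -> V) :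
  (forall e, F (opp_node e) = F e) ->
  \sum_e F e = F [ffun=> inord 1] + (\sum_(e in half_nodes) F e) *+ 2.
Proof.
move=> F_opp; rewrite (bigD1 [ffun=> inord 1]) //=; congr (_ + _).
rewrite (bigID (mem half_nodes)) /= mulr2n; congr (_ + _).
  apply: eq_bigl => e; rewrite -opp_node_fixed inE.
  by case: eqP => // ->; rewrite ltnn.
(* Negation carries the nonzero vectors outside [half_nodes] onto [half_nodes]. *)
rewrite (reindex_inj (inv_inj opp_nodeK)) /=.
apply: eq_big => [e|e _]; last exact: F_opp.
rewrite -opp_node_fixed !inE opp_nodeK -leqNgt ltn_neqAle; congr (_ && _).
by rewrite val_eqE (inj_eq enum_rank_inj).
Qed.

(** Summing the constant 1 over all nodes gives [3 ^ m = 1 + 2 * #|half_nodes|]. *)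
Lemma card_half_nodes : #|half_nodes| = ((3 ^ m - 1) %/ 2)%N.
Proof.
have := @sum_nodes_half nat (fun=> 1%N) (fun=> erefl).
have -> : \sum_(e : {ffun 'I_m -> 'I_3}) 1%N = (3 ^ m)%N.
  by rewrite -[LHS]/(\sum_e 1)%N sum1_card card_ffun !card_ord.
have -> : \sum_(e in half_nodes) 1%N = #|half_nodes| by exact: sum1_card.
by move=> ->; rewrite mulr2n !natrDE; lia.
Qed.

End Decomposition.

Lemma waring_prod_sqr (K : numFieldType) (m : nat) : (0 < m)%N ->
  has_waring_decomposition (2 * m) (\prod_(i < m) 'X_i ^+ 2 : {mpoly K[m]})
    ((3 ^ m - 1) %/ 2)%N.
Proof.
move=> m_gt0; rewrite -card_half_nodes.
have [N N_gt0] := sum_all_nodes K m.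
rewrite sum_nodes_half => [|e]; last first.
  by rewrite coef_opp form_opp exprM sqrrN -exprM.
(* The term at [e = 0] is a multiple of [0 ^+ (2 * m)], which is zero only because [m > 0]. *)
rewrite form0 expr0n muln_eq0 /= -[m == 0%N]negbK -lt0n m_gt0 scaler0 add0r.
set c := N%:R * _ => sumE.
have c_neq0 : c != 0 by rewrite mulf_neq0 ?expf_neq0 ?pnatr_eq0 -?lt0n.
(* The factor 2 accounts for the pair [e], [-e]. *)
exists (fun i => c^-1 * 2 * coef K (enum_val i)),
  (fun i => form K (enum_val i)).
split=> [i|]; first exact: form_homog.
pose term (e : {ffun 'I_m -> 'I_3}) :=
  (c^-1 * 2 * coef K e) *: form K e ^+ (2 * m).
rewrite -(big_enum_val term) /term.
under [RHS]eq_bigr do rewrite -scalerA.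
rewrite -scaler_sumr -scalerA scaler_nat sumE.
by rewrite scalerA mulVf // scale1r.
Qed.

Lemma waring_rank_le (K : fieldType) (m d s : nat) (F : {mpoly K[m]}) :
  has_waring_decomposition d F s ->
  exists r : nat, is_waring_rank d F r /\ (r <= s)%N.
Proof.
(* Classical logic turns decomposability into a boolean predicate, so that a least length can be
   taken. *)
move=> decF; pose P r := `[< has_waring_decomposition d F r >].
have exP : exists r, P r by exists s; apply/asboolP.
exists (ex_minn exP); case: ex_minnP => r /asboolP decr min_r.
by split; [split=> // t dect|]; apply: min_r; apply/asboolP.
Qed.

Theorem proposition3p6 (R : realType) (n : nat) :
  exists r : nat,
    is_waring_rank (2 * n.+1)
      (\prod_(i < n.+1) 'X_i ^+ 2 : {mpoly R[n.+1]}) r /\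
    (r <= (3 ^ n.+1 - 1) %/ 2)%N.
Proof. exact: waring_rank_le (waring_prod_sqr R (ltn0Sn n)). Qed.
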